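(* There is no deterministic distributed algorithm in the LOCAL model that finds a maximal half-integral matching in every graph of maximum degree at most $4$ in $o(\log^* n)$ rounds, where $n$ is the number of nodes of the input graph.
   Context: Fractional matching: for a finite simple graph $G=(V,E)$ and $x\colon E\to[0,1]$, write $x[v]=\sum_{e\in E: v\in e} x(e)$ for $v \in V$. The function $x$ is a fractional matching if $x[v]\le 1$ for all $v\in V$; it is a maximal fractional matching if in addition for every edge $\{u,v\}\in E$ at least one endpoint is saturated, i.e. $x[u]=1$ or $x[v]=1$. A maximal half-integral matching is a maximal fractional matching $x$ with $x(e)\in\{0,\frac12,1\}$ for every $e\in E$. PN (port-numbering) model: each node of the input graph $G$ is a computer and each edge is a communication link. An adversary chooses a port numbering: each node $v$ of degree $\deg(v)$ refers to its incident edges by the numbers $1,\dotsc,\deg(v)$. Initially each node knows only its degree (and the global maximum degree bound), and nodes of the same degree start in the same state. Computation is deterministic and proceeds in synchronous rounds; in each round each node sends a message (of arbitrary size) through each port, receives a message from each port, and updates its state by arbitrary local computation as a function of its current state and the received messages. A node may stop after any number of rounds and announce its local output, here the value $x(e)$ of each incident edge $e$ (the two endpoints of an edge must announce the same value). The running time is the number of rounds until all nodes have stopped; as a function of $n$ it is the worst case over all inputs with $n$ nodes. An algorithm must be correct for every input graph in the family and every port numbering. LOCAL model: the same as the PN model, except that each node is additionally given as input a unique identifier, chosen by an adversary from a set of size polynomial in $n=|V|$, e.g. $\{1,\dotsc,n^c\}$ for a fixed constant $c \ge 1$. An algorithm must be correct for every choice of unique identifiers. $\log^* n$ denotes the iterated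 logarithm. *)

(* Defs.v *)
From mathcomp Require Import all_boot all_order all_algebra.
From mathcomp Require Import all_classical all_reals all_analysis.

Set Implicit Arguments.
Unset Strict Implicit.
Unset Printing Implicit Defensive.

Import Order.TTheory GRing.Theory Num.Theory.
Import numFieldNormedType.Exports.

(** * Finite simple graphs *)

Record sgraph := SGraph {
  svertex :> finType;
  adj : rel svertex;
  adj_sym : symmetric adj;
  adj_irr : irreflexive adj
}.

Definition edges (G : sgraph) : {set {set G}} :=
  [set e | [exists u, exists v, adj u v && (e == [set u; v])]].

Definition deg (G : sgraph) (v : G) : nat := #|[set u | adj v u]|.

Definition max_degree (G : sgraph) : nat := \max_(v : G) deg v.

(** * Fractional matchings *)

Section Matching.
Local Open Scope ring_scope.
Variables (R : realType) (G : sgraph).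

(* An edge weighting is a function on all sets of vertices; only its values on
   [edges G] are ever used. *)
Implicit Type x : {set G} -> R.

Definition load x (v : G) : R := \sum_(e in edges G | v \in e) x e.

Definition fractional_matching x : Prop :=
  (forall e, e \in edges G -> 0 <= x e <= 1) /\ (forall v, load x v <= 1).

Definition maximal_fractional_matching x : Prop :=
  fractional_matching x /\
  (forall u v : G, adj u v -> load x u = 1 \/ load x v = 1).

Definition maximal_half_integral_matching x : Prop :=
  maximal_fractional_matching x /\
  (forall e, e \in edges G -> [\/ x e = 0, x e = 1 / 2 | x e = 1]).

End Matching.

(** * The LOCAL model *)

(* [p v] lists the neighbours of [v] in the order of the ports of [v]: port [i]
   of [v] (ports are counted from 0) is the edge to [nth _ (p v) i], and the
   edge to a neighbour [u] is port [index u (p v)] of [v]. *)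
Definition port_numbering (G : sgraph) (p : G -> seq G) : Prop :=
  forall v, uniq (p v) /\ (forall u, (u \in p v) = adj v u).

Definition unique_ids (c : nat) (G : sgraph) (id : G -> nat) : Prop :=
  injective id /\ (forall v, 1 <= id v <= #|G| ^ c).

(* The initial state depends on the degree and the identifier only (in
   particular, not on the number of nodes). [la_send s i] is the message sent
   through port [i] in state [s]. [la_recv s ms] is the new state, where [ms]
   lists the received messages in the order of the ports. [la_output s] is
   [None] while the node is running; [Some o] means that the node has stopped
   and announces the local output [o i] for its port [i]. *)
Record local_algorithm (O : Type) := LocalAlgorithm {
  la_state : Type;
  la_msg : Type;
  la_init : nat -> nat -> la_state;
  la_send : la_state -> nat -> la_msg;
  la_recv : la_state -> seq la_msg -> la_state;
  la_output : la_state -> option (nat -> O)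
}.

Section Execution.
Variables (O : Type) (A : local_algorithm O).
Variables (G : sgraph) (p : G -> seq G) (id : G -> nat).

(* The state of a stopped node no longer changes; its neighbours keep receiving
   the messages determined by that state. *)
Definition round (s : G -> la_state A) : G -> la_state A := fun v =>
  if la_output (s v) is Some _ then s v
  else la_recv (s v) [seq la_send (s u) (index v (p u)) | u <- p v].

Definition run (t : nat) : G -> la_state A :=
  iter t round (fun v => la_init A (deg v) (id v)).

(* After [t] rounds all nodes have stopped, and both endpoints of every edge
   [e] have announced [x e]. *)
Definition outputs_within (t : nat) (x : {set G} -> O) : Prop :=
  forall v, exists2 o, la_output (run t v) = Some o &
    forall u, adj v u -> o (index u (p v)) = x [set v; u].

End Execution.

(* [A] finds a maximal half-integral matching in every graph of maximum degree
   at most [D] with identifiers from {1, ..., n ^ c}, for every port numbering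
   and every choice of identifiers, in at most [T n] rounds on [n] nodes. *)
Definition finds_maximal_half_integral_matching (R : realType) (D c : nat)
    (A : local_algorithm R) (T : nat -> nat) : Prop :=
  forall (G : sgraph) (p : G -> seq G) (id : G -> nat),
    max_degree G <= D -> port_numbering p -> unique_ids c id ->
    exists2 x : {set G} -> R,
      maximal_half_integral_matching x & outputs_within A p id (T #|G|) x.

(** * The iterated logarithm *)

Lemma iter_up_log_le1 (n : nat) : exists k, iter k (up_log 2) n <= 1.
Proof.
exists n; suff H k m : m <= k.+1 -> iter k (up_log 2) m <= 1 by apply: H.
elim: k m => [|k IHk] m lemk //; rewrite iterSr; apply: IHk.
by apply: up_log_min => //; apply: leq_trans lemk (ltn_expl _ _).
Qed.

(* [up_log 2] is the ceiling of the binary logarithm.  Rounding up at every step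
   does not change the number of steps needed to get down to at most 1:
   log^(k) n <= 1 exactly when n is at most a tower of k twos. *)
Definition log_star (n : nat) : nat := ex_minn (iter_up_log_le1 n).

(* Main.v *)
Require Import Defs.
From mathcomp Require Import all_boot all_order all_algebra.
From mathcomp Require Import all_classical all_reals all_analysis.
From mathcomp Require Import zify lra.
Import Order.TTheory GRing.Theory Num.Theory.
Import numFieldNormedType.Exports.

(** Use identifiers of product form: place an n x n grid with row labels x and
    column labels y so that node (i, j) has the identifier encoding the pair
    (x_i, y_j).  The view of a node after t rounds then depends only on O(t)
    labels, so Linial's argument finds, for t = o(log* n), labels for which the
    outputs do not change when passing from row I to row I+1, and from column I
    to column I+1, for some I > t.  Adjacent nodes with equal outputs have equal
    loads, so they are saturated.

    Let h and k be the weights of the two kinds of edges at node (I, I); by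
    invariance in both directions, 2h + 2k = 1.  In row I, the edges along the
    row have weights k_0, k_1, ... and the two other edges at node (I, j) have
    equal weights h_j, so 2h_0 + k_0 = 1 at the border and
    2h_j + k_(j-1) + k_j = 1 afterwards; as the weights are half-integral, every
    k_j is an integer.  So k is an integer, and likewise h, which is absurd. *)

Set Implicit Arguments.
Unset Strict Implicit.
Unset Printing Implicit Defensive.

Local Open Scope nat_scope.

(** * Linial's lower bound for shift invariance *)

Definition increasing (n : nat) (s : seq 'I_n) : bool :=
  sorted (fun a b : 'I_n => a < b) s.

Lemma increasing_uniq (n : nat) (s : seq 'I_n) : increasing s -> uniq s.
Proof.
apply: sorted_uniq => [a b c|a]; first exact: ltn_trans.
exact: ltnn.
Qed.

(* Linial's lower bound: a coincidence of the sets of values that [f] takes on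
   the increasing extensions of windows of length [k] yields a coincidence of [f]
   on windows of length [k.+1]. *)
Lemma window_coincidence (n k : nat) (C : finType) (f : seq 'I_n -> C) :
  iter k (expn 2) #|C| < n ->
  exists s : seq 'I_n, [/\ increasing s, size s = k.+2
    & f (take k.+1 s) = f (behead s)].
Proof.
elim: k C f => [|k IHk] C f ltCn.
  have : ~~ injectiveb (fun a : 'I_n => f [:: a]).
    apply/negP => /injectiveP/leq_card; rewrite card_ord leqNgt.
    by move: ltCn => /= ->.
  case/injectivePn => a [b neq_ab eq_f].
  case: (ltngtP a b) => [ltab|ltba|/val_inj/eqP].
  - by exists [:: a; b]; split => //=; rewrite /increasing /= ltab.
  - by exists [:: b; a]; split => //=; rewrite /increasing /= ltba.
  - by rewrite (negPf neq_ab).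
pose next (s : seq 'I_n) (z : 'I_n) := all (fun a : 'I_n => a < z) s.
pose g (s : seq 'I_n) := [set f (rcons s z) | z in next s].
have [|s [incr_s sz_s eq_g]] := IHk _ g.
  by rewrite -cardsT -powersetT card_powerset cardsT -iterSr.
have trans : transitive (fun a b : 'I_n => a < b).
  by move=> a b c; apply: ltn_trans.
case/lastP: s => [//|s z] in incr_s sz_s eq_g *.
have sz' : size s = k.+1 by move: sz_s; rewrite size_rcons => -[].
move: eq_g; rewrite -cats1 take_size_cat // cats1 => eq_g.
(* Since [z] extends the front window, equality of the two value sets puts this value among those of
   the shifted window; the label [w] that realizes it is then appended after [z]. *)
have : f (rcons s z) \in g (behead (rcons s z)).
  rewrite -eq_g; apply: imset_f; rewrite unfold_in.
  move: incr_s; rewrite /increasing sorted_pairwise // pairwise_rcons.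
  by case/andP.
case/imsetP => w; rewrite unfold_in => next_w eq_f.
case: s sz' incr_s {sz_s eq_g} eq_f next_w => [//|a s] sz' incr_s eq_f next_w.
exists (rcons (rcons (a :: s) z) w); split.
- move: incr_s; rewrite /increasing /= => incr_s.
  rewrite rcons_path incr_s last_rcons.
  by move/allP: next_w; apply; rewrite /= mem_rcons inE eqxx.
- by rewrite !size_rcons sz'.
- have -> : take k.+2 (rcons (rcons (a :: s) z) w) = rcons (a :: s) z.
    by rewrite -cats1 take_size_cat // size_rcons sz'.
  by rewrite eq_f.
Qed.

(** * Tower bounds *)

Definition tower (k : nat) : nat := iter k (expn 2) 1.

Lemma ltn_tower k : k < tower k.
Proof. by elim: k => // k IHk; apply: leq_ltn_trans IHk (ltn_expl _ _). Qed.

Lemma towerS k : tower k.+1 = 2 ^ tower k. Proof. by []. Qed.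

Lemma leq_tower : {homo tower : j k / j <= k}.
Proof.
apply: homo_leq => [//|j k l|k]; first exact: leq_trans.
by rewrite towerS ltnW // ltn_expl.
Qed.

Lemma exp_leq_tower k u : u <= tower k -> 2 ^ u <= tower k.+1.
Proof. by move=> leu; rewrite towerS leq_exp2l. Qed.

Lemma iter_exp_leq_tower j k u :
  u <= tower k -> iter j (expn 2) u <= tower (j + k).
Proof. by elim: j => //= j IHj /IHj/exp_leq_tower. Qed.

(** As [u * v <= 2 ^ (u + v)], a product costs two levels. The waste is harmless: only a height
    linear in the number of rounds is wanted. *)
Lemma mul_leq_tower k u v : u <= tower k -> v <= tower k -> u * v <= tower k.+2.
Proof.
move=> leu lev; apply: (@leq_trans (2 ^ (u + v))).
  by rewrite expnD leq_mul // ltnW // ltn_expl.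
apply: exp_leq_tower; apply: leq_trans (leq_add leu lev) _.
rewrite addnn -muln2 mulnC towerS; case: (tower k) => // w.
by rewrite expnS leq_mul2l ltn_expl.
Qed.

Lemma expn_leq_tower k u v :
  u <= tower k -> v <= tower k -> u ^ v <= tower k.+3.
Proof.
move=> leu lev; apply: (@leq_trans (2 ^ (u * v))).
  case: v {lev} => [|v]; first by rewrite muln0.
  by rewrite expnM leq_exp2r // ltnW // ltn_expl.
exact/exp_leq_tower/mul_leq_tower.
Qed.

Lemma succ_leq_tower k u : u <= tower k -> u.+1 <= tower k.+1.
Proof. by move=> leu; rewrite towerS (leq_ltn_trans leu) // ltn_expl. Qed.

(** Each [up_log 2] removes one level of the tower. *)
Lemma log_star_tower n k : n <= tower k -> log_star n <= k.
Proof.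
move=> len; rewrite /log_star; case: ex_minnP => i _; apply.
elim: k n len => //= k IHk n len; rewrite -iterS iterSr; apply: IHk.
exact: up_log_min.
Qed.

(** * Graphs and executions *)

Lemma port_numbering_deg (G : sgraph) (p : G -> seq G) v :
  port_numbering p -> size (p v) = deg v.
Proof.
move=> /(_ v)[/card_uniqP <- mem_p]; apply: eq_card => u.
by rewrite mem_p inE.
Qed.

Lemma load_ports (R : realType) (G : sgraph) (p : G -> seq G)
    (x : {set G} -> R) v :
  port_numbering p -> load x v = (\sum_(u <- p v) x [set v; u])%R.
Proof.
move=> /(_ v)[uniq_p mem_p].
rewrite big_uniq //= /load.
have inj : {in p v &, injective (fun u : G => [set v; u])}.
  move=> u w; rewrite !mem_p => vu vw /setP/(_ u).
  rewrite !inE eqxx orbT => /esym/orP[] /eqP // eq_uv.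
  by move: vu; rewrite eq_uv adj_irr.
rewrite -(big_imset (fun e => x e) inj) /=; apply: eq_bigl => e.
apply/andP/imsetP => [[]|[u]].
  rewrite inE => /existsP[a /existsP[b /andP[ab /eqP->]]].
  rewrite !inE => /orP[]/eqP eq_v; rewrite -eq_v in ab *.
    by exists b; rewrite ?mem_p.
  by exists a; [rewrite mem_p adj_sym | rewrite finset.setUC].
rewrite mem_p => vu ->; rewrite !inE eqxx; split => //.
by apply/existsP; exists v; apply/existsP; exists u; rewrite vu eqxx.
Qed.

Lemma run_stopped (O : Type) (A : local_algorithm O) (G : sgraph)
    (p : G -> seq G) (id : G -> nat) (s t : nat) v o :
  s <= t -> la_output (run A p id s v) = Some o ->
  run A p id t v = run A p id s v.
Proof.
move=> /subnKC <-; elim: (t - s) => [|d IHd] out_s; first by rewrite addn0.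
by rewrite addnS /run iterS -/(run A p id _) /round IHd // out_s.
Qed.

(** * Grids with product labels *)

Section Path.
Variable T : eqType.
Implicit Types (x : seq T) (a b : T).

Definition path_adj x : rel T := fun a b =>
  [&& a \in x, b \in x &
     (index b x == (index a x).+1) || (index a x == (index b x).+1)].

(** The successor comes before the predecessor at every node, so the ports of interior nodes look
    alike and only labels can break the symmetry. *)
Definition path_ports x a : seq T :=
  if a \in x then
    let i := index a x in
    (if i.+1 < size x then [:: nth a x i.+1] else [::]) ++
    (if 0 < i then [:: nth a x i.-1] else [::])
  else [::].

Lemma path_adj_sym x : symmetric (path_adj x).
Proof. by move=> a b; rewrite /path_adj andbCA orbC. Qed.

Lemma path_adj_irr x : irreflexive (path_adj x).
Proof. by move=> a; rewrite /path_adj; lia. Qed.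

Lemma path_ports_nth a0 x i : uniq x -> i < size x ->
  path_ports x (nth a0 x i) =
    (if i.+1 < size x then [:: nth a0 x i.+1] else [::]) ++
    (if 0 < i then [:: nth a0 x i.-1] else [::]).
Proof.
move=> uniq_x lti; rewrite /path_ports mem_nth // index_uniq //.
congr (_ ++ _); case: ifP => // h; congr [:: _]; apply: set_nth_default => //.
by lia.
Qed.

Lemma mem_path_ports x a b : uniq x -> (b \in path_ports x a) = path_adj x a b.
Proof.
move=> uniq_x; rewrite /path_adj /path_ports; case: (boolP (a \in x)) => //= xa.
have lta : index a x < size x by rewrite index_mem.
have nthE i : i < size x -> (b == nth a x i) = (b \in x) && (index b x == i).
  move=> lti; apply/eqP/andP => [->|[xb /eqP<-]]; last by rewrite nth_index.
  by rewrite mem_nth // index_uniq.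
rewrite mem_cat; case: (ltnP (index a x).+1) => h1;
  case: (posnP (index a x)) => h2 //=;
  rewrite ?inE ?in_nil ?nthE ?orbF //=; try lia.
all: case xb : (b \in x) => //=; have : index b x < size x by rewrite index_mem.
all: lia.
Qed.

Lemma path_ports_uniq x a : uniq x -> uniq (path_ports x a).
Proof.
move=> uniq_x; rewrite /path_ports; case: ifP => // xa.
have lta : index a x < size x by rewrite index_mem.
case: ifP => h1; case: ifP => h2 //=; rewrite andbT inE nth_uniq //; lia.
Qed.

Lemma size_path_ports x a : size (path_ports x a) <= 2.
Proof. by rewrite /path_ports; do 3?case: ifP. Qed.

End Path.

Section Grid.
Variables (m M : nat).
Local Notation V := ('I_m * 'I_M)%type.
Implicit Types (x : seq 'I_m) (y : seq 'I_M).

(** All pairs of labels are vertices, those outside [x] and [y] being isolated. Hence the number of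
    nodes is [m * M] for every choice of [x] and [y]. *)
Definition grid_adj x y : rel V := fun u v =>
  [&& u.1 \in x, u.2 \in y, v.1 \in x, v.2 \in y &
    (u.2 == v.2) && path_adj x u.1 v.1 || (u.1 == v.1) && path_adj y u.2 v.2].

Lemma grid_adj_sym x y : symmetric (grid_adj x y).
Proof.
move=> [a b] [a' b']; rewrite /grid_adj /= path_adj_sym (path_adj_sym y).
by rewrite (eq_sym a) (eq_sym b); do 4!case: (_ \in _).
Qed.

Lemma grid_adj_irr x y : irreflexive (grid_adj x y).
Proof. by move=> [a b]; rewrite /grid_adj !path_adj_irr !andbF. Qed.

Definition grid x y : sgraph := SGraph (@grid_adj_sym x y) (@grid_adj_irr x y).

Definition grid_ports x y (v : V) : seq V :=
  if (v.1 \in x) && (v.2 \in y) then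
    [seq (a, v.2) | a <- path_ports x v.1] ++
    [seq (v.1, b) | b <- path_ports y v.2]
  else [::].

Definition grid_id (v : V) : nat := (v.1 * M + v.2).+1.

Lemma grid_port_numbering x y :
  uniq x -> uniq y ->
  port_numbering (grid_ports x y : grid x y -> seq (grid x y)).
Proof.
move=> uniq_x uniq_y [a b]; rewrite /grid_ports /=; split.
  case: ifP => // _; rewrite cat_uniq !map_inj_uniq => [|c d [] //|c d [] //].
  rewrite !path_ports_uniq //= andbT; apply/hasPn => _ /mapP[b' yb' ->].
  apply/mapP => -[a' _ [_ eq_b]]; move: yb'.
  by rewrite mem_path_ports // eq_b path_adj_irr.
move=> [a' b']; rewrite /adj /= /grid_adj /=.
case xa : (a \in x) => //=; case yb : (b \in y) => //=.
have memx : ((a', b') \in [seq (c, b) | c <- path_ports x a]) =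
    (b == b') && path_adj x a a'.
  apply/mapP/andP => [[c + [-> ->]]|[/eqP<- h]].
    by rewrite mem_path_ports.
  by exists a'; rewrite ?mem_path_ports.
have memy : ((a', b') \in [seq (a, c) | c <- path_ports y b]) =
    (a == a') && path_adj y b b'.
  apply/mapP/andP => [[c + [-> ->]]|[/eqP<- h]].
    by rewrite mem_path_ports.
  by exists b'; rewrite ?mem_path_ports.
rewrite mem_cat memx memy /path_adj xa yb /=.
case: (eqVneq b b') => [<-|_]; case: (eqVneq a a') => [<-|_];
  rewrite ?xa ?yb ?orbF ?andbF //=.
 by case: (a' \in x).
by case: (b' \in y).
Qed.

Lemma grid_max_degree x y : uniq x -> uniq y -> max_degree (grid x y) <= 4.
Proof.
move=> uniq_x uniq_y; apply/bigmax_leqP => v _.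
rewrite -(port_numbering_deg _ (grid_port_numbering uniq_x uniq_y)) /grid_ports.
case: ifP => // _; rewrite size_cat !size_map.
exact: leq_add (size_path_ports _ _) (size_path_ports _ _).
Qed.

Lemma grid_unique_ids c x y :
  1 <= c -> unique_ids c (grid_id : grid x y -> nat).
Proof.
move=> c1; split.
  move=> [a b] [a' b'] [eq_id].
  have M0 : 0 < M by apply: leq_ltn_trans (ltn_ord b).
  have eqb : b = b'.
    apply: val_inj; have := congr1 (modn^~ M) eq_id.
    by rewrite !modnMDl !modn_small.
  congr (_, _) => //; apply: val_inj; have := congr1 (divn^~ M) eq_id.
  by rewrite !divnMDl // !divn_small // !addn0.
move=> [a b]; rewrite /grid_id /= card_prod !card_ord.
have ltab : a * M + b < m * M.
    apply: (@leq_trans (a.+1 * M)); first by rewrite mulSn addnC ltn_add2r.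
    by rewrite leq_mul2r ltn_ord orbT.
case: c c1 => // c _; apply: (leq_trans ltab).
by rewrite expnS leq_pmulr // expn_gt0 (leq_ltn_trans _ ltab).
Qed.

(* [P s a] ensures that the part of the path [x] that a node with label [a] sees
   in [s] rounds is the same in the path [x']. *)
Definition insulated (T : eqType) (x x' : seq T) (P : nat -> pred T) : Prop :=
  forall s a, P s a ->
    [/\ (a \in x) = (a \in x'), path_ports x a = path_ports x' a
      & forall r, s = r.+1 -> forall b, b \in a :: path_ports x a -> P r b].

Lemma insulated_refl (T : eqType) (x : seq T) : insulated x x (fun _ => predT).
Proof. by []. Qed.

(** Induction on the rounds: ports, hence degrees, agree. A move along one path keeps the other
    label, which is why [insulated] passes to [a] itself as well as to its neighbours. *)
Lemma run_insulated (O : Type) (A : local_algorithm O) x x' y y' P Q :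
  uniq x -> uniq x' -> uniq y -> uniq y' ->
  insulated x x' P -> insulated y y' Q ->
  forall s a b, P s a -> Q s b ->
  run A (grid_ports x y : grid x y -> _) grid_id s (a, b) =
  run A (grid_ports x' y' : grid x' y' -> _) grid_id s (a, b).
Proof.
move=> ux ux' uy uy' insP insQ.
have eq_ports s a b : P s a -> Q s b ->
    grid_ports x y (a, b) = grid_ports x' y' (a, b).
  by move=> /insP[xa pa _] /insQ[yb pb _]; rewrite /grid_ports /= xa yb pa pb.
elim=> [|s IHs] a b Pa Qb.
  rewrite /run /= -(port_numbering_deg _ (grid_port_numbering ux uy)).
  by rewrite -(port_numbering_deg _ (grid_port_numbering ux' uy')) (eq_ports 0).
have [_ _ /(_ s erefl) Pnb] := insP _ _ Pa.
have [_ _ /(_ s erefl) Qnb] := insQ _ _ Qb.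
have Pa' : P s a by apply: Pnb; rewrite mem_head.
have Qb' : Q s b by apply: Qnb; rewrite mem_head.
rewrite /run !iterS -!/(run A _ _ _) /round IHs //; case: (la_output _) => // .
congr (la_recv _ _); rewrite -(eq_ports s) //.
apply/eq_in_map => -[a' b'] uv.
have [Pa2 Qb2] : P s a' /\ Q s b'.
  move: uv; rewrite /grid_ports /=; case: ifP => // _; rewrite mem_cat.
  case/orP => /mapP[c pc [-> ->]]; split=> //.
    by apply: Pnb; rewrite inE pc orbT.
  by apply: Qnb; rewrite inE pc orbT.
by rewrite IHs // (eq_ports s a' b').
Qed.

End Grid.

Lemma index_path_ports (T : eqType) (x : seq T) a b : uniq x ->
  b \in a :: path_ports x a ->
  index b x <= (index a x).+1 /\ index a x <= (index b x).+1.
Proof.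
move=> uniq_x; rewrite inE mem_path_ports // => /orP[/eqP-> //|].
by case/and3P => _ _; lia.
Qed.

(** A node at distance [s] must still have its successor in the truncated path, or its degree would
    reveal the cut; hence the 2. *)
Lemma insulated_take (T : eqType) (x : seq T) k : uniq x -> k <= size x ->
  insulated x (take k x) (fun s a => index a x + s + 2 <= k).
Proof.
move=> uniq_x lek s a lta; split.
- by rewrite in_take_leq // -index_mem; lia.
- have lt_index : index a x < k by lia.
  have a_take : a \in take k x by rewrite in_take_leq.
  have eq_index : index a (take k x) = index a x.
    by rewrite -[in RHS](cat_take_drop k x) index_cat a_take.
  rewrite /path_ports a_take (mem_take a_take) eq_index size_takel //.
  rewrite !nth_take; [|lia|lia].
  have -> : (index a x).+1 < size x by lia.
  by have -> : (index a x).+1 < k by lia.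
- by move=> r eq_s b /(index_path_ports uniq_x); lia.
Qed.

(** Positions shift by one, but ports depend on neighbours only. A node at distance [s] must keep
    its predecessor, so its index must be at least 2. *)
Lemma insulated_behead (T : eqType) (x : seq T) : uniq x ->
  insulated x (behead x) (fun s a => s + 2 <= index a x < size x).
Proof.
case: x => [_ s a|c x uniq_x s a lta]; first by rewrite andbF.
have neq_ca : (c == a) = false by move: lta => /=; case: eqP => //; lia.
split.
- by rewrite inE eq_sym neq_ca.
- move: lta; rewrite /path_ports inE eq_sym /= neq_ca -index_mem /= => lta.
  have -> : index a x < size x by lia.
  case eq_i : (index a x) => [|i] /=; first by lia.
  by rewrite !ltnS.
- move=> r eq_s b mem_b; have := index_path_ports uniq_x mem_b.
  have : b \in c :: x.
    move: mem_b; rewrite inE mem_path_ports // => /orP[/eqP->|/and3P[]//].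
    by rewrite -index_mem; lia.
  by rewrite -index_mem; lia.
Qed.

(** * Twins and parity *)

Section Code.
Variable R : realType.

(* A finite code that determines half-integral outputs at the ports 0, ..., 3. *)
Definition out_code (o : option (nat -> R)) : {ffun 'I_4 -> bool * bool} :=
  [ffun k : 'I_4 => if o is Some f then (f k == 0, f k == 1 / 2)%R
                    else (false, false)].

(** Two booleans separate the weights 0, 1/2 and 1, and four ports cover all edges at a node. *)
Lemma same_code_weights (A : local_algorithm R) (G : sgraph) (p : G -> seq G)
    id t (w : {set G} -> R) (u v : G) :
  port_numbering p -> maximal_half_integral_matching w ->
  outputs_within A p id t w -> size (p u) = size (p v) -> size (p u) <= 4 ->
  out_code (la_output (run A p id t u)) =
  out_code (la_output (run A p id t v)) ->
  [seq w [set u; z] | z <- p u] = [seq w [set v; z] | z <- p v].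
Proof.
move=> pn_p [_ half_w] out_w eq_sz le4 eq_code.
have port a k : k < size (p a) ->
    [\/ w [set a; nth a (p a) k] = 0, w [set a; nth a (p a) k] = 1 / 2
      | w [set a; nth a (p a) k] = 1]%R /\
    forall o, la_output (run A p id t a) = Some o ->
      o k = w [set a; nth a (p a) k].
  move=> ltk; have [uniq_p mem_p] := pn_p a.
  have adj_a : adj a (nth a (p a) k) by rewrite -mem_p mem_nth.
  split.
    apply: half_w; rewrite inE; apply/existsP; exists a.
    by apply/existsP; exists (nth a (p a) k); rewrite adj_a eqxx.
  move=> o'; have [f -> eq_f] := out_w a => -[<-].
  by rewrite -eq_f // index_uniq.
apply: (@eq_from_nth _ 0%R); first by rewrite !size_map.
move=> k; rewrite size_map => ltk.
have ltk' : k < size (p v) by rewrite -eq_sz.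
rewrite (nth_map u) // (nth_map v) //.
have [half_u out_u] := port u k ltk; have [half_v out_v] := port v k ltk'.
have [f Eo _] := out_w u; have [f' Eo' _] := out_w v.
have := congr1 (fun c : {ffun 'I_4 -> bool * bool} =>
  c (Ordinal (leq_trans ltk le4))) eq_code.
rewrite !ffunE Eo Eo' /= (out_u _ Eo) (out_v _ Eo').
have h20 : (1 / 2 == 0 :> R)%R = false by apply/negP => /eqP; lra.
have h10 : (1 == 0 :> R)%R = false by apply/negP => /eqP; lra.
have h12 : (1 == 1 / 2 :> R)%R = false by apply/negP => /eqP; lra.
by case: half_u half_v => -> [] -> //;
  rewrite ?(eq_sym 0%R) ?eqxx ?h20 ?h10 ?h12.
Qed.

Lemma twins_saturated (G : sgraph) (p : G -> seq G)
    (w : {set G} -> R) (u v : G) :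
  port_numbering p -> maximal_half_integral_matching w -> adj u v ->
  [seq w [set u; z] | z <- p u] = [seq w [set v; z] | z <- p v] ->
  (\sum_(r <- [seq w [set u; z] | z <- p u]) r = 1)%R.
Proof.
move=> pn_p [[_ max_w] _] uv eq_w.
have [] := max_w _ _ uv; rewrite (load_ports _ _ pn_p) => sat.
  by rewrite big_map.
by rewrite eq_w big_map.
Qed.

Definition half_integral (r : R) : Prop := [\/ r = 0, r = 1 / 2 | r = 1]%R.

(** Both [2 * h] and [c] are integers, so [k] is one too. *)
Lemma integral_of_saturated (h k c : R) : half_integral h -> half_integral k ->
  (c = 0 \/ c = 1 -> 2 * h + k + c = 1 -> k = 0 \/ k = 1)%R.
Proof.
by move=> [] -> [] -> [] -> E; (try by left); (try by right); exfalso; lra.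
Qed.

(* The weights of the edges at node (i, j) of a grid, where [H i j] is the
   weight of the edge from (i, j) to (i+1, j), and [K i j] that of the edge from
   (i, j) to (i, j+1). *)
Definition grid_weights (n : nat) (H K : nat -> nat -> R) (i j : nat) : seq R :=
  ((if i.+1 < n then [:: H i j] else [::]) ++
   (if 0 < i then [:: H i.-1 j] else [::])) ++
  ((if j.+1 < n then [:: K i j] else [::]) ++
   (if 0 < j then [:: K i j.-1] else [::])).

Lemma grid_parity (n t : nat) (H K : nat -> nat -> R) : t.+3 < n ->
  (forall i j, i.+1 < n -> j < n -> half_integral (H i j)) ->
  (forall i j, i < n -> j.+1 < n -> half_integral (K i j)) ->
  (forall j, j < n -> grid_weights n H K t.+1 j = grid_weights n H K t.+2 j) ->
  (forall i, i < n -> grid_weights n H K i t.+1 = grid_weights n H K i t.+2) ->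
  (forall j, j < n -> (\sum_(r <- grid_weights n H K t.+1 j) r = 1)%R) ->
  (forall i, i < n -> (\sum_(r <- grid_weights n H K i t.+1) r = 1)%R) -> False.
Proof.
move=> lt_n halfH halfK twinH twinK satH satK.
have lt2 : t.+2 < n by lia.
(* The backward ports of the twins at rows [t.+1] and [t.+2] carry these two weights. *)
have Hint j : j < n -> H t j = H t.+1 j.
  by move=> ltj; have := twinH j ltj; rewrite /grid_weights lt_n lt2 /= => -[].
have Kint i : i < n -> K i t = K i t.+1.
  move=> lti; have := twinK i lti; rewrite /grid_weights lt_n lt2 /=.
  by do 2!case: ifP => _ /=; case.
have intK j : j <= t.+1 -> (K t.+1 j = 0 \/ K t.+1 j = 1)%R.
  elim: j => [_|j IHj lej].
    have := satH 0 ltac:(lia); rewrite /grid_weights lt2 /=.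
    have -> : 1 < n by lia.
    rewrite /= !big_cons big_nil Hint; [|lia].
  move=> sat.
    (* The border node has no preceding edge, so the third term is 0. *)
    apply: (@integral_of_saturated (H t.+1 0) _ 0%R);
      [|by apply: halfK; lia|by left|lra].
    by apply: halfH; lia.
  have := satH j.+1 ltac:(lia); rewrite /grid_weights lt2 /=.
  have -> : j.+2 < n by lia.
  rewrite /= !big_cons big_nil Hint; [|lia].
  move=> sat.
  apply: (@integral_of_saturated (H t.+1 j.+1) _ (K t.+1 j));
    [| |by apply: IHj; lia|lra].
    by apply: halfH; lia.
  by apply: halfK; lia.
have intH i : i <= t.+1 -> (H i t.+1 = 0 \/ H i t.+1 = 1)%R.
  elim: i => [_|i IHi lei].
    have := satK 0 ltac:(lia); rewrite /grid_weights lt2 /=.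
    have -> : 1 < n by lia.
    rewrite /= !big_cons big_nil Kint; [|lia].
  move=> sat.
    apply: (@integral_of_saturated (K 0 t.+1) _ 0%R);
      [|by apply: halfH; lia|by left|lra].
    by apply: halfK; lia.
  have := satK i.+1 ltac:(lia); rewrite /grid_weights lt2 /=.
  have -> : i.+2 < n by lia.
  rewrite /= !big_cons big_nil Kint; [|lia].
  move=> sat.
  apply: (@integral_of_saturated (K i.+1 t.+1) _ (H i t.+1));
    [| |by apply: IHi; lia|lra].
    by apply: halfK; lia.
  by apply: halfH; lia.
(* At the crossing of the two invariant lines the load is [2 * H + 2 * K], an even integer, yet it
   equals 1. *)
have := satK t.+1 ltac:(lia); rewrite /grid_weights lt2 /=.
rewrite !big_cons big_nil Kint ?Hint; [|lia|lia].
move=> sat.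
by case: (intK t.+1 (leqnn _)) (intH t.+1 (leqnn _)) sat => -> [] ->; lra.
Qed.

End Code.

(** * Grids with two adjacent rows and two adjacent columns of equal outputs *)

Section Twins.
Variables (R : realType) (A : local_algorithm R) (m M : nat).
Implicit Types (x : seq 'I_m) (y : seq 'I_M).

Definition grid_code t x y a b : {ffun 'I_4 -> bool * bool} :=
  out_code (la_output (run A (grid_ports x y : grid x y -> _)
    (@grid_id m M) t (a, b))).

Lemma grid_code_insulated t x x' y y' P Q a b :
  uniq x -> uniq x' -> uniq y -> uniq y' ->
  insulated x x' P -> insulated y y' Q -> P t a -> Q t b ->
  grid_code t x y a b = grid_code t x' y' a b.
Proof.
by move=> *; rewrite /grid_code; congr (out_code (la_output _));
  apply: run_insulated; eauto.
Qed.

(* [y] is chosen first, so as to work for all [x] simultaneously; this is why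
   the bound on [M] depends on [m]. *)
Lemma twin_grid (t : nat) (a0 : 'I_m) (b0 : 'I_M) :
  iter (2 * t + 2) (expn 2) (256 ^ (2 * t + 4)) < m ->
  iter (2 * t + 2) (expn 2) (256 ^ (m ^ (2 * t + 4) * (2 * t + 4))) < M ->
  exists x y, [/\ uniq x, uniq y, size x = 2 * t + 4 & size y = 2 * t + 4] /\
    (forall j, j < 2 * t + 4 ->
       grid_code t x y (nth a0 x t.+1) (nth b0 y j) =
       grid_code t x y (nth a0 x t.+2) (nth b0 y j)) /\
    (forall i, i < 2 * t + 4 ->
       grid_code t x y (nth a0 x i) (nth b0 y t.+1) =
       grid_code t x y (nth a0 x i) (nth b0 y t.+2)).
Proof.
(* A window has [2 * t + 3] labels: a centre at index [t.+1], [t] labels seen on each side, and one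
   more at each end to fix the degrees. A path of [N] labels holds two consecutive windows. *)
move=> ltm ltM; set N := 2 * t + 4 in ltm ltM *.
have card_code : #|{: {ffun 'I_4 -> bool * bool}}| = 256.
  by rewrite card_ffun card_prod card_bool card_ord.
(* As [x] is still unknown, the colour of a window tabulates the codes in its middle column for
   every tuple of row labels and every row position. *)
pose fy (s : seq 'I_M) :
    {ffun N.-tuple 'I_m * 'I_N -> {ffun 'I_4 -> bool * bool}} :=
  [ffun z : N.-tuple 'I_m * 'I_N =>
     grid_code t (z.1 : seq 'I_m) s (tnth z.1 z.2) (nth b0 s t.+1)].
have [|y [incr_y sz_y eq_y]] := @window_coincidence M (2 * t + 2) _ fy.
  by rewrite card_ffun card_code card_prod card_tuple !card_ord.
pose fx (s : seq 'I_m) : {ffun 'I_N -> {ffun 'I_4 -> bool * bool}} :=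
  [ffun j : 'I_N => grid_code t s y (nth a0 s t.+1) (nth b0 y j)].
have [|x [incr_x sz_x eq_x]] := @window_coincidence m (2 * t + 2) _ fx.
  by rewrite card_ffun card_code card_ord.
clear ltm ltM.
have ux := increasing_uniq incr_x; have uy := increasing_uniq incr_y.
have szx : size x = N by rewrite sz_x /N; lia.
have szy : size y = N by rewrite sz_y /N; lia.
have tx : uniq (take (2 * t + 2).+1 x) by apply: take_uniq.
have ty : uniq (take (2 * t + 2).+1 y) by apply: take_uniq.
have bx : uniq (behead x) by case: (x) ux => //= ? ? /andP[].
have byy : uniq (behead y) by case: (y) uy => //= ? ? /andP[].
exists x, y; split; first by split.
have eqN : N = 2 * t + 4 by [].
have lex : (2 * t + 2).+1 <= size x by lia.
have ley : (2 * t + 2).+1 <= size y by lia.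
have Ptx : index (nth a0 x t.+1) x + t + 2 <= (2 * t + 2).+1.
  by rewrite index_uniq ?szx //; lia.
have Pty : index (nth b0 y t.+1) y + t + 2 <= (2 * t + 2).+1.
  by rewrite index_uniq ?szy //; lia.
have Pbx : t + 2 <= index (nth a0 x t.+2) x < size x.
  by rewrite index_uniq ?szx //; lia.
have Pby : t + 2 <= index (nth b0 y t.+2) y < size y.
  by rewrite index_uniq ?szy //; lia.
split=> k ltk.
  have := congr1 (fun c : {ffun 'I_N -> {ffun 'I_4 -> bool * bool}} =>
    c (Ordinal ltk)) eq_x.
  (* The centres of the two windows are the entries [t.+1] and [t.+2] of [x]; insulation carries
     their codes over to the whole path. *)
  rewrite !ffunE /= nth_behead nth_take; last by lia.
  rewrite -(@grid_code_insulated _ x _ y y _ _ _ _ ux tx uy uy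
    (insulated_take ux lex) (insulated_refl y)) //.
  by rewrite -(@grid_code_insulated _ x _ y y _ _ _ _ ux bx uy uy
    (insulated_behead ux) (insulated_refl y)).
have szxN : size x == N by rewrite szx.
have := congr1
  (fun c : {ffun N.-tuple 'I_m * 'I_N -> {ffun 'I_4 -> bool * bool}} =>
  c (Tuple szxN, Ordinal ltk)) eq_y.
rewrite !ffunE /= !(tnth_nth a0) /= nth_behead nth_take; last by lia.
rewrite -(@grid_code_insulated _ x x y _ _ _ _ _ ux ux uy ty
  (insulated_refl x) (insulated_take uy ley)) //.
by rewrite -(@grid_code_insulated _ x x y _ _ _ _ _ ux ux uy byy
  (insulated_refl x) (insulated_behead uy)).
Qed.

End Twins.

Lemma twin_grid_unsolvable (R : realType) (A : local_algorithm R) (m M t : nat)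
    (a0 : 'I_m) (b0 : 'I_M) (x : seq 'I_m) (y : seq 'I_M) n
    (w : {set grid x y} -> R) :
  uniq x -> uniq y -> size x = n -> size y = n -> t.+3 < n ->
  (forall j, j < n -> grid_code A t x y (nth a0 x t.+1) (nth b0 y j) =
                      grid_code A t x y (nth a0 x t.+2) (nth b0 y j)) ->
  (forall i, i < n -> grid_code A t x y (nth a0 x i) (nth b0 y t.+1) =
                      grid_code A t x y (nth a0 x i) (nth b0 y t.+2)) ->
  maximal_half_integral_matching w ->
  ~ outputs_within A (grid_ports x y : grid x y -> _) (@grid_id m M) t w.
Proof.
move=> ux uy szx szy lt_n twinx twiny max_w out_w.
pose p : grid x y -> seq (grid x y) := grid_ports x y.
pose V i j : grid x y := (nth a0 x i, nth b0 y j).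
pose H i j := w [set V i j; V i.+1 j]; pose K i j := w [set V i j; V i j.+1].
have pn_p : port_numbering p by apply: grid_port_numbering.
have weightsE i j : i < n -> j < n ->
    [seq w [set V i j; z] | z <- p (V i j)] = grid_weights n H K i j.
  move=> lti ltj; rewrite /p /grid_ports /V /= !mem_nth ?szx ?szy //=.
  rewrite !path_ports_nth ?szx ?szy // !map_cat /grid_weights.
  congr ((_ ++ _) ++ (_ ++ _)); case: ifP => //= pos; congr [:: w _].
    (* A backward port lists the ends of its edge in the opposite order. *)
    by case: i pos {lti} => // i _; rewrite finset.setUC.
  by case: j pos {ltj} => // j _; rewrite finset.setUC.
have le4 v : size (p v) <= 4.
  rewrite (port_numbering_deg _ pn_p).
  by apply: leq_trans (grid_max_degree ux uy); apply: leq_bigmax.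
have size_weights i j : i < n -> j < n ->
    size (p (V i j)) = size (grid_weights n H K i j).
  by move=> lti ltj; rewrite -weightsE // size_map.
(* Codes determine weights only for nodes of equal degree; twins have equal degrees because both of
   their lines are interior. *)
have interior i : 0 < i -> i.+1 < n -> forall j,
    size (grid_weights n H K i j) = size (grid_weights n H K t.+1 j) /\
    size (grid_weights n H K j i) = size (grid_weights n H K j t.+1).
  move=> i0 ltin j; rewrite /grid_weights i0 ltin /=.
  have -> : t.+2 < n by lia.
  by split; do 2!case: ifP => _.
have lt1 : t.+1 < n by lia.
have lt2 : t.+2 < n by lia.
have twin_row j : j < n ->
    grid_weights n H K t.+1 j = grid_weights n H K t.+2 j.
  move=> ltj; rewrite -!weightsE //.
  apply: (same_code_weights pn_p max_w out_w) => //; last exact: twinx.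
  by rewrite !size_weights // (interior t.+2 _ lt_n j).1.
have twin_col i : i < n ->
    grid_weights n H K i t.+1 = grid_weights n H K i t.+2.
  move=> lti; rewrite -!weightsE //.
  apply: (same_code_weights pn_p max_w out_w) => //; last exact: twiny.
  by rewrite !size_weights // (interior t.+2 _ lt_n i).2.
have adjH i j : i.+1 < n -> j < n -> adj (V i j) (V i.+1 j).
  move=> lti ltj; rewrite /adj /= /grid_adj /path_adj /=
     !mem_nth ?szx ?szy //; try lia.
  by rewrite !index_uniq ?szx ?szy ?eqxx //; lia.
have adjK i j : i < n -> j.+1 < n -> adj (V i j) (V i j.+1).
  move=> lti ltj; rewrite /adj /= /grid_adj /path_adj /=
     !mem_nth ?szx ?szy //; try lia.
  by rewrite !index_uniq ?szx ?szy ?eqxx ?orbT //; lia.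
have half_edge u v : adj u v -> half_integral (w [set u; v]).
  move=> uv; apply: max_w.2; rewrite inE; apply/existsP; exists u.
  by apply/existsP; exists v; rewrite uv eqxx.
apply: (@grid_parity R n t H K lt_n) => //.
- by move=> i j lti ltj; apply/half_edge/adjH.
- by move=> i j lti ltj; apply/half_edge/adjK.
- move=> j ltj; rewrite -weightsE //.
  apply: (twins_saturated pn_p max_w (adjH _ _ lt2 ltj)).
  by rewrite !weightsE // twin_row.
- move=> i lti; rewrite -weightsE //.
  apply: (twins_saturated pn_p max_w (adjK _ _ lti lt2)).
  by rewrite !weightsE // twin_col.
Qed.

(** * The number of labels *)

(** The least number of labels above the threshold for [m] in [twin_grid]. *)
Definition row_labels (s : nat) : nat :=
  (iter (2 * s + 2) (expn 2) (256 ^ (2 * s + 4))).+1.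

Definition column_labels (s : nat) : nat :=
  (iter (2 * s + 2) (expn 2)
     (256 ^ (row_labels s ^ (2 * s + 4) * (2 * s + 4)))).+1.

Lemma exp256 k : 256 ^ k = 2 ^ (8 * k).
Proof. by rewrite expnM. Qed.

Lemma row_labels_tower s : row_labels s <= tower (18 * s + 36).
Proof.
rewrite /row_labels exp256.
(* One level is for the successor, [2 * s + 2] for the iterations, and [(16 * s + 32).+1] bound
   [2 ^ (8 * (2 * s + 4))]. *)
have -> : 18 * s + 36 = ((2 * s + 2) + (16 * s + 32).+1).+1 by lia.
apply/succ_leq_tower/iter_exp_leq_tower/exp_leq_tower.
by apply: leq_trans (ltnW (ltn_tower _)); lia.
Qed.

Lemma column_labels_tower s : column_labels s <= tower (20 * s + 50).
Proof.
have leq_small u : u <= 18 * s + 36 -> u <= tower (18 * s + 36).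
  by move=> leu; apply: leq_trans leu (ltnW (ltn_tower _)).
have pow_le : row_labels s ^ (2 * s + 4) <= tower (18 * s + 36).+3.
  by apply: expn_leq_tower; [exact: row_labels_tower|apply: leq_small; lia].
have prod_le : (2 * s + 4) * 8 <= tower (18 * s + 36).+3.
  by apply: leq_trans (leq_tower (_ : 18 * s + 36 <= _));
    [apply: leq_small; lia|lia].
have exp_le : 256 ^ (row_labels s ^ (2 * s + 4) * (2 * s + 4)) <=
              tower (18 * s + 36).+3.+3.
  rewrite exp256 mulnC -mulnA; apply: exp_leq_tower.
  exact: mul_leq_tower.
apply: leq_trans (succ_leq_tower (iter_exp_leq_tower (2 * s + 2) exp_le)) _.
by apply: leq_tower; lia.
Qed.

Lemma log_star_labels s :
  log_star (row_labels s * column_labels s) <= 20 * s + 52.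
Proof.
apply: log_star_tower; have -> : 20 * s + 52 = (20 * s + 50).+2 by lia.
apply: mul_leq_tower.
  by apply: leq_trans (row_labels_tower s) _; apply: leq_tower; lia.
exact: column_labels_tower.
Qed.

(** This brings the grid size past the threshold of the little-o hypothesis. *)
Lemma labels_unbounded s : s <= row_labels s * column_labels s.
Proof.
apply: (@leq_trans (row_labels s)); last by rewrite leq_pmulr.
apply: leqW; apply: (@leq_trans (256 ^ (2 * s + 4))).
  by apply: leq_trans (ltnW (ltn_expl _ _)) => //; lia.
elim: (2 * s + 2) => //= k IHk; exact: leq_trans IHk (ltnW (ltn_expl _ _)).
Qed.

Theorem corollary1p4 (R : realType) (c : nat) (hc : (1 <= c)%N) :
  ~ exists (A : local_algorithm R) (T : nat -> nat),
      ((fun n : nat => (T n)%:R%R : R) =o_\oo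
         (fun n : nat => (log_star n)%:R%R : R))%classic /\
      finds_maximal_half_integral_matching 4 c A T.
Proof.
move=> [A [T [littleT find_A]]].
(* Since 72 = 20 + 52, [20 * s + 52 <= 72 * s] for positive [s], so this factor forces the running
   time on the grid down to at most [s]. *)
move/eqoP: littleT => /(_ (72^-1)%R ltac:(by rewrite invr_gt0))[n0 _ small].
pose s := n0.+1; set m := row_labels s; set M := column_labels s.
have le_T : T (m * M) <= s.
  have n0_le : n0 <= m * M by apply: leq_trans (labels_unbounded s).
  have := small (m * M) n0_le; rewrite /= !normr_nat => le_eps.
  have log_le : ((log_star (m * M))%:R <= 72 * s%:R :> R)%R.
    rewrite -natrM ler_nat; apply: leq_trans (log_star_labels s) _.
    by rewrite /s; lia.
  by rewrite -(ler_nat R); lra.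
have m0 : 0 < m by []. have M0 : 0 < M by [].
pose a0 := Ordinal m0; pose b0 := Ordinal M0.
have [||x [y [[ux uy szx szy] [twinx twiny]]]] := @twin_grid R A m M s a0 b0.
- exact: ltnSn.
- exact: ltnSn.
have [w max_w out_w] := find_A (grid x y) (grid_ports x y) (@grid_id m M)
  (grid_max_degree ux uy) (grid_port_numbering ux uy) (grid_unique_ids x y hc).
apply: (twin_grid_unsolvable ux uy szx szy _ twinx twiny max_w); first by lia.
(* Nodes stopped after [T (m * M)] rounds keep their outputs up to round [s]. *)
move=> v; have [f out_v eq_f] := out_w v; exists f => //.
rewrite (run_stopped _ out_v) // card_prod !card_ord. exact: le_T.
Qed.
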